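(* Let $r,k \in \mathbb{N}$, let $(G,+)$ be an abelian group, and let $A \subseteq G$ be a union of $k$ unbounded generalised arithmetic progressions in $G$. Then $A$ is an asymptotic $(r,(4rk)^k)$-approximate group.
   Context: $\mathbb{N}$ denotes the set of positive integers. For a subset $A$ of an abelian group $(G,+)$ and $n \in \mathbb{N}$, $nA := \{a_1+\cdots+a_n : a_1,\ldots,a_n \in A\}$ denotes the $n$-fold sum set. For subsets $X, Y$ of $G$, $X+Y := \{x+y : x\in X, y\in Y\}$. A subset of $G$ is an unbounded generalised arithmetic progression (also called an unbounded linear set) of dimension $d$ if it has the form $P(a,b_1,\ldots,b_d) := \{a+n_1b_1+\cdots+n_db_d : n_1,\ldots,n_d \in \mathbb{Z}_{\geq 0}\}$ for some $a,b_1,\ldots,b_d \in G$. (The $k$ progressions in the union may have different dimensions.) For $r,l\in\mathbb{N}$, a subset $A \subseteq G$ is an asymptotic $(r,l)$-approximate group if there exists $h_0 \in \mathbb{N}$ such that for every natural number $h \geq h_0$ there is a set $X_h \subseteq G$ with $|X_h| \leq l$ and $(hr)A \subseteq X_h + hA$. *)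

(* Defs.v *)
From mathcomp Require Import all_boot all_algebra.
From mathcomp Require Import classical_sets functions cardinality.

Set Implicit Arguments.
Unset Strict Implicit.
Unset Printing Implicit Defensive.

Local Open Scope classical_set_scope.
Local Open Scope card_scope.
Local Open Scope ring_scope.

Definition sumset (G : zmodType) (X Y : set G) : set G :=
  [set x + y | x in X & y in Y].

(* The $n$-fold sum set $nA$: the summands are allowed to repeat. *)
Definition nfold_sumset (G : zmodType) (n : nat) (A : set G) : set G :=
  [set x | exists a : 'I_n -> G, (forall i, A (a i)) /\ x = \sum_(i < n) a i].

Definition progression (G : zmodType) (d : nat) (a : G) (b : 'I_d -> G) :
    set G :=
  [set a + \sum_(i < d) b i *+ n i | n in [set: 'I_d -> nat]].

(* Dimension 0 gives the singletons, which are also the progressions of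
   dimension 1 with step 0, so allowing d = 0 adds no new sets. *)
Definition is_progression (G : zmodType) (P : set G) : Prop :=
  exists (d : nat) (a : G) (b : 'I_d -> G), P = progression a b.

(* The progressions may overlap or coincide and have different dimensions. *)
Definition is_union_of_progressions (G : zmodType) (k : nat) (A : set G) :
    Prop :=
  exists P : 'I_k -> set G,
    (forall i, is_progression (P i)) /\ A = \bigcup_i P i.

(* [X #<= `I_l] says that X injects into {0, ..., l - 1}, i.e. that X is
   finite with at most l elements. *)
Definition asymptotic_approx_group (G : zmodType) (r l : nat) (A : set G) :
    Prop :=
  exists2 h0 : nat, (0 < h0)%N &
    forall h : nat, (h0 <= h)%N ->
      exists X : set G,
        (X #<= `I_l) /\
        nfold_sumset (h * r)%N A `<=` sumset X (nfold_sumset h A).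

(* Main.v *)
Require Import Defs.
From mathcomp Require Import all_boot all_algebra.
From mathcomp Require Import classical_sets functions cardinality.
From mathcomp Require Import zify.

Set Implicit Arguments.
Unset Strict Implicit.
Unset Printing Implicit Defensive.

Import GRing.Theory.
Local Open Scope classical_set_scope.
Local Open Scope card_scope.
Local Open Scope ring_scope.

(** Write the j-th progression as [a_j + M_j] with [M_j] a submonoid.  Since
    sums of elements of [M_j] stay in [M_j], the set [nA] is the union, over all
    tuples [m] of naturals with sum [n], of the sets
    [\sum_j m_j a_j + \sum_j M_j], the second sum being over the [j] with
    [m_j > 0] only ([nfold_sumset_bigcup]).

    As [0] lies in every [M_j], enlarging the support of [m] enlarges that second
    sum.  So a set of translates of [hA] covers [(hr)A] as soon as every tuple
    [m] of sum [hr] can be replaced by a tuple [n] of sum [h] whose support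
    contains that of [m], with few possible values for the vector
    [\sum_j (m_j - n_j) a_j].  This is a rounding problem on tuples
    ([round_multiplicities]): lower every coordinate other than the 0-th by a
    multiple of [q], the integer part of [h / k], so that a positive coordinate
    ends up between 1 and [q].  These [k - 1] coordinates then have sum at most
    [(k - 1) q < h], so the 0-th one can be chosen positive and making the total
    [h].  If [h >= k] then [q >= 1] and [h < (q + 1) k <= 2 k q], so [hr < 2 r k q]
    and each multiple of [q] involved has at most [2 r k] possible values.  Those
    multiples determine the translation vector, because the sums of [m] and [n]
    are fixed ([sum_recentre]). *)

(** * Progressions and their sum sets *)

Definition is_submonoid (G : zmodType) (M : set G) : Prop :=
  M 0 /\ forall x y, M x -> M y -> M (x + y).

(** The translation part and the submonoid come as a pair so that finite choice
    can pick both for all the progressions of a union at once. *)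
Lemma progression_translate (G : zmodType) (P : set G) :
  is_progression P ->
  exists aM : G * set G,
    is_submonoid aM.2 /\ P = [set aM.1 + w | w in aM.2].
Proof.
case=> d [a [b ->]]; exists (a, progression 0 b); split=> /=; first split.
- by exists (fun=> 0%N) => //; rewrite big1 ?addr0.
- move=> _ _ [n _ <-] [p _ <-]; exists (fun i => (n i + p i)%N) => //.
  rewrite !add0r -big_split /=; apply: eq_bigr => i _.
  by rewrite mulrnDr.
- apply/seteqP; split=> x /=.
  + move=> [n _ <-]; exists (\sum_(i < d) b i *+ n i) => //.
    by exists n; rewrite ?add0r.
  + by move=> [_ [n _ <-] <-]; exists n; rewrite ?add0r.
Qed.

Lemma nfold_sumset0 (G : zmodType) (A : set G) : nfold_sumset 0 A 0.
Proof. by exists (fun=> 0); rewrite big_ord0; split=> // -[]. Qed.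

Lemma nfold_sumsetD (G : zmodType) (A : set G) (m n : nat) (x y : G) :
  nfold_sumset m A x -> nfold_sumset n A y -> nfold_sumset (m + n) A (x + y).
Proof.
move=> [a [Aa ->]] [b [Ab ->]].
exists (fun i => match fintype.split i with inl j => a j | inr j => b j end).
split.
  by move=> i; case: (fintype.split i).
rewrite big_split_ord /=; congr (_ + _); apply: eq_bigr => i _.
- by case: split_ordP => j; [move/lshift_inj->|move/eqP; rewrite eq_lrshift].
- by case: split_ordP => j; [move/eqP; rewrite eq_rlshift|move/rshift_inj->].
Qed.

Lemma nfold_sumset_sum (G : zmodType) (A : set G) (k : nat)
    (n : 'I_k -> nat) (x : 'I_k -> G) :
  (forall j, nfold_sumset (n j) A (x j)) ->
  nfold_sumset (\sum_j n j)%N A (\sum_j x j).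
Proof.
move=> Ax; elim/big_ind2: _ => //; first exact: nfold_sumset0.
by move=> ? ? ? ?; apply: nfold_sumsetD.
Qed.

(** One summand carries [w] and the others carry 0.  With no summand at all
    there is nothing to carry [w], hence the condition at [n = 0]. *)
Lemma nfold_sumset_translate (G : zmodType) (M : set G) (a w : G) (n : nat) :
  M 0 -> M w -> (n = 0%N -> w = 0) ->
  nfold_sumset n [set a + v | v in M] (a *+ n + w).
Proof.
move=> M0 Mw; case: n => [->//|n _].
  by rewrite addr0; apply: nfold_sumset0.
exists (fun i => a + (if i == ord0 then w else 0)); split.
  by move=> i; case: eqP => _; [exists w|exists 0].
by rewrite big_split sumr_const card_ord /= -big_mkcond big_pred1_eq.
Qed.

Lemma nfold_sumsetS (G : zmodType) (A B : set G) (n : nat) :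
  A `<=` B -> nfold_sumset n A `<=` nfold_sumset n B.
Proof. by move=> AB _ [a [Aa ->]]; exists a; split=> // i; apply: AB. Qed.

(** Grouping the summands by the translate they come from, [m j] counts those
    coming from the j-th one and [w j] is the sum of their submonoid parts. *)
Lemma nfold_sumset_bigcup (G : zmodType) (k n : nat) (a : 'I_k -> G)
    (M : 'I_k -> set G) (x : G) :
  (forall j, is_submonoid (M j)) ->
  nfold_sumset n (\bigcup_j [set a j + w | w in M j]) x <->
  exists (m : 'I_k -> nat) (w : 'I_k -> G),
    [/\ (\sum_j m j)%N = n, forall j, M j (w j), forall j, m j = 0%N -> w j = 0
      & x = \sum_j (a j *+ m j + w j)].
Proof.
move=> monM; split=> [[y [Ay ->]]|[m [w [<- Mw w0 ->]]]]; last first.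
  apply: nfold_sumset_sum => j; have [M0 _] := monM j.
  apply: nfold_sumsetS (nfold_sumset_translate (a j) M0 (Mw j) (w0 j)).
  by move=> z Pz; exists j.
have /fin_all_exists[f fP] i : exists jw : 'I_k * G,
    M jw.1 jw.2 /\ y i = a jw.1 + jw.2.
  by have [j _ [w Mw <-]] := Ay i; exists (j, w).
exists (fun j => \sum_(i | (f i).1 == j) 1)%N.
exists (fun j => \sum_(i | (f i).1 == j) (f i).2); split.
- by rewrite -[RHS]card_ord -sum1_card (partition_big (fun i => (f i).1) xpredT).
- move=> j; have [M0 MD] := monM j.
  by elim/big_ind: _ => // i /eqP<-; have [] := fP i.
- move=> j; rewrite sum1_card => /card0_eq none.
  by apply: big_pred0 => i; have := none i; rewrite unfold_in.
rewrite (partition_big (fun i => (f i).1) xpredT) //=.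
apply: eq_bigr => j _; rewrite sum1_card -sumr_const -big_split /=.
by apply: eq_bigr => i /eqP<-; have [_ ->] := fP i.
Qed.

(** * Rounding multiplicities *)

(** Off [ord0], a positive [m j] is reduced modulo [q] to a residue between 1
    and [q] instead of 0 and [q - 1], so that it stays positive; [n ord0] is what
    is left of [h], which [k * q < h] keeps positive. *)
Lemma round_multiplicities (k h N q : nat) (m : 'I_k.+1 -> nat) :
  (k * q < h)%N -> (\sum_j m j < N * q)%N ->
  exists (c : {ffun 'I_k.+1 -> 'I_N}) (n : 'I_k.+1 -> nat),
    [/\ (\sum_j n j)%N = h, forall j, n j = 0%N -> m j = 0%N
      & forall j, j != ord0 -> m j = (q * c j + n j)%N].
Proof.
move=> kq_lt_h m_lt.
have q_gt0 : (0 < q)%N by case: q m_lt {kq_lt_h} => //; lia.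
have c_lt j : ((m j).-1 %/ q < N)%N.
  rewrite ltn_divLR //; apply: leq_ltn_trans m_lt.
  by rewrite (bigD1 j) //=; lia.
pose res j := if m j == 0%N then 0%N else ((m j).-1 %% q).+1.
have res_le j : (res j <= q)%N.
  by rewrite /res; case: eqP => // _; rewrite ltn_mod.
have sum_res_lt : (\sum_(j < k.+1 | j != ord0) res j < h)%N.
  apply: leq_ltn_trans kq_lt_h.
  apply: leq_trans (leq_sum _ (fun j _ => res_le j)) _.
  rewrite sum_nat_const; have := cardC1 (@ord0 k).
  by rewrite card_ord /= => ->.
exists [ffun j => Ordinal (c_lt j)].
exists (fun j => if j == ord0 then h - \sum_(i | i != ord0) res i else res j)%N.
split=> [|j|j /negPf j0].
- rewrite (bigD1 ord0) //= -[RHS](@subnK (\sum_(j | j != ord0) res j)%N).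
    by congr (_ + _)%N; apply: eq_bigr => j /negPf->.
  exact: ltnW.
- case: eqP => _; first by move/eqP; rewrite subn_eq0 leqNgt sum_res_lt.
  by rewrite /res; case: eqP.
- rewrite j0 ffunE /= /res; case: eqP => [->|]; first by rewrite div0n muln0.
  have := divn_eq (m j).-1 q; lia.
Qed.

(** * Covering by translates *)

(** Once [\sum_j n j] is known, the coefficient of one generator, taken as the
    origin [a0], no longer matters. *)
Lemma sum_recentre (G : zmodType) (k : nat) (a : 'I_k -> G) (a0 : G)
    (n : 'I_k -> nat) :
  \sum_j a j *+ n j = a0 *+ (\sum_j n j) + \sum_j (a j - a0) *+ n j.
Proof.
rewrite -sumrMnr -big_split /=; apply: eq_bigr => j _.
by rewrite -mulrnDl addrC subrK.
Qed.

Lemma card_range_fin (F : finType) (T : Type) (f : F -> T) :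
  range f #<= `I_#|F|.
Proof.
apply: card_le_trans (card_image_le f _) _; apply/pcard_leP/injfunPex.
exists (fun x => enum_rank x : nat).
  by move=> x _ /=; apply: ltn_ord.
by move=> x y _ _ /ord_inj/enum_rank_inj.
Qed.

Theorem theorem1p5 (r k : nat) (hr : (0 < r)%N) (hk : (0 < k)%N)
    (G : zmodType) (A : set G) (hA : is_union_of_progressions k A) :
  asymptotic_approx_group r ((4 * r * k) ^ k)%N A.
Proof.
case: hA => P [progP ->]; case: k hk P progP => [//|k _] P progP.
have /fin_all_exists[aM aMP] j := progression_translate (progP j).
pose a j := (aM j).1; pose M j := (aM j).2.
have monM j : is_submonoid (M j) by have [] := aMP j.
have -> : \bigcup_j P j = \bigcup_j [set a j + w | w in M j].
  by apply: eq_bigcup => // j _; have [_ ->] := aMP j.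
exists k.+1 => // h k_le_h.
pose q := (h %/ k.+1)%N; pose N := (4 * r * k.+1)%N.
(* The 0-th summand of the sum is 0, so the 0-th entry of [c] is a dummy. *)
pose shift (c : {ffun 'I_k.+1 -> 'I_N}) :=
  a ord0 *+ (h * r - h) + \sum_j (a j - a ord0) *+ (q * c j).
exists (range shift); split.
  by have := card_range_fin shift; rewrite card_ffun !card_ord.
move=> x /(nfold_sumset_bigcup _ _ _ monM)[m [w [sum_m Mw w0 ->]]].
have q_gt0 : (0 < q)%N by rewrite divn_gt0.
have h_eq := divn_eq h k.+1.
have h_mod : (h %% k.+1 < k.+1)%N by rewrite ltn_mod.
have kq_lt_h : (k * q < h)%N by rewrite h_eq -/q; lia.
have m_lt : (\sum_j m j < N * q)%N.
  have h_lt : (h < 2 * k.+1 * q)%N by rewrite h_eq -/q; nia.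
  rewrite sum_m /N; nia.
have [c [n [sum_n n0 m_eq]]] := round_multiplicities kq_lt_h m_lt.
exists (shift c); first by exists c.
exists (\sum_j (a j *+ n j + w j)).
  apply/(nfold_sumset_bigcup _ _ _ monM); exists n, w; split=> // j nj0.
  exact/w0/n0.
rewrite !big_split /= addrA; congr (_ + _).
rewrite !(sum_recentre a (a ord0)) sum_m sum_n /shift addrACA -mulrnDr.
rewrite subnK ?leq_pmulr //.
congr (_ + _); rewrite -big_split /=; apply: eq_bigr => j _.
have [->|j0] := eqVneq j ord0; first by rewrite subrr !mul0rn addr0.
by rewrite -mulrnDr -m_eq.
Qed.
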